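(* Fix constants $\lambda>0$ and $\epsilon\in(0,1)$. Suppose that for each $n$ each of $n$ items is defective independently with probability $p=\frac{\lambda}{\log n}$ (i.i.d. prior). Then there exists $n_0$ such that for all $n>n_0$, any nonadaptive test scheme (test design together with any decoding method) that uses $T$ tests with $$T\le (1-\epsilon)\frac{\lambda}{\lambda+\log^2 2}\,n$$ to identify the set of defective items has error probability $1-o(1)$ as $n\to\infty$.
   Context: $\log$ denotes the natural logarithm. Nonadaptive group testing: a test is a subset of items, and its outcome is positive iff it contains at least one defective item (the logical OR of the defectivity indicators of its items). All tests are fixed before any outcomes are seen; a decoding method maps the vector of outcomes to an estimate of the defective set, and an error occurs when this estimate differs from the true defective set. *)

(* Defs.v *)
From HB Require Import structures.
From mathcomp Require Import all_boot all_order all_algebra.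
From mathcomp Require Import reals exp.
Set Implicit Arguments. Unset Strict Implicit. Unset Printing Implicit Defensive.
Import Order.TTheory GRing.Theory Num.Theory.
Local Open Scope ring_scope.

(* A test is a subset of the items 'I_n; a nonadaptive design is a
   (fixed) sequence of tests; T = size of the sequence. *)

Definition test_outcome (n : nat) (D : {set 'I_n}) (t : {set 'I_n}) : bool :=
  [exists i in t, i \in D].

Definition outcomes (n : nat) (tests : seq {set 'I_n}) (D : {set 'I_n})
  : seq bool := [seq test_outcome D t | t <- tests].

Definition prior (R : realType) (n : nat) (p : R) (D : {set 'I_n}) : R :=
  p ^+ #|D| * (1 - p) ^+ (n - #|D|).

Definition success_prob (R : realType) (n : nat) (p : R)
  (tests : seq {set 'I_n}) (dec : seq bool -> {set 'I_n}) : R :=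
  \sum_(D : {set 'I_n}) @prior R n p D * ((dec (outcomes tests D) == D)%:R).

(* Main.v *)
(* Call a test small if it has at most l^3 items, where l = ln n; all larger
   tests are positive with high probability. Let V be the set of items lying in
   at most l^4 small tests. An item i is masked if every small test through i
   contains a defective item of V other than i. By Harris's inequality i is
   masked with probability at least the product of 1 - (1 - p)^(m - 1) over the
   small tests a through i, where m = #|a :&: V|. Items alone in some a :&: V are
   discarded; there are at most T of them. For the others, minus the logarithms
   of these products sum to at most about T (ln 2)^2 / p, because
   m * - ln (1 - (1 - p)^(m - 1)) is essentially at most (ln 2)^2 / p, the
   maximum of ln u * ln (1 - u) being (ln 2)^2. As T (1 + (ln 2)^2 / lam) <=
   (1 - eps) n, a positive fraction of all items are masked with probability at
   least n^(eps / 4 - 1).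

   Among these items choose a set S, of size n up to polylogarithmic factors,
   whose neighbourhoods are pairwise disjoint. Masked items of S can be flipped
   without changing any outcome, so given k of them the decoder is right with
   probability at most (1 - p)^k; by independence the expectation of this bound
   factors over S, and it tends to 0. *)
Require Import Defs.
From HB Require Import structures.
From mathcomp Require Import all_boot all_order all_algebra.
From mathcomp Require Import ring lra.
From mathcomp Require Import functions reals.
From mathcomp Require Import topology normedtype sequences derive realfun exp.
Set Implicit Arguments. Unset Strict Implicit. Unset Printing Implicit Defensive.
Import Order.TTheory GRing.Theory Num.Theory.
Import numFieldNormedType.Exports.
Local Open Scope ring_scope.

(** * Independent Bernoulli subsets *)

Section BernoulliSets.
Variables (R : realDomainType) (I : finType) (p : R).

Definition bern (b : bool) : R := if b then p else 1 - p.

Definition bern_mass (D : {set I}) : R := \prod_i bern (i \in D).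

Definition Ex (f : {set I} -> R) : R := \sum_D bern_mass D * f D.

Lemma bern_massE (D : {set I}) :
  bern_mass D = p ^+ #|D| * (1 - p) ^+ (#|I| - #|D|).
Proof.
rewrite /bern_mass (bigID (mem D)) /= -(cardC (mem D)) addKn; congr (_ * _).
  by rewrite (eq_bigr (fun=> p)) ?prodr_const // => i ->.
rewrite (eq_bigr (fun=> 1 - p)) => [|i /negPf-> //].
by rewrite prodr_const; congr (_ ^+ _); apply: eq_card => i; rewrite !inE.
Qed.

Lemma Ex_prod (f : I -> bool -> R) :
  Ex (fun D => \prod_i f i (i \in D))
  = \prod_i (p * f i true + (1 - p) * f i false).
Proof.
transitivity (\prod_i \sum_(b : bool) bern b * f i b); last first.
  by apply: eq_bigr => i _; rewrite big_bool.
rewrite bigA_distr_bigA /= /Ex (reindex (fun g : {ffun I -> bool} => [set i | g i])) /=.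
  apply: eq_bigr => g _; rewrite /bern_mass -big_split /=.
  by apply: eq_bigr => i _; rewrite inE.
exists (fun D : {set I} => [ffun i => i \in D]) => [g _|D _].
  by apply/ffunP => i; rewrite ffunE inE.
by apply/setP => i; rewrite inE ffunE.
Qed.

Lemma Ex_const (c : R) : Ex (fun=> c) = c.
Proof.
rewrite /Ex -mulr_suml; set m := \sum_D _; suff -> : m = 1 by rewrite mul1r.
transitivity (Ex (fun D => \prod_(i : I) 1)).
  by apply: eq_bigr => D _; rewrite big1 ?mulr1.
rewrite (Ex_prod (fun _ _ => 1)) big1 // => i _.
by rewrite !mulr1 addrC subrK.
Qed.

Lemma eq_Ex f g : f =1 g -> Ex f = Ex g.
Proof. by move=> fg; apply: eq_bigr => D _; rewrite fg. Qed.

Lemma ExD f g : Ex (fun D => f D + g D) = Ex f + Ex g.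
Proof. by rewrite /Ex -big_split; apply: eq_bigr => D _; rewrite mulrDr. Qed.

Lemma ExZ c f : Ex (fun D => c * f D) = c * Ex f.
Proof. by rewrite /Ex mulr_sumr; apply: eq_bigr => D _; rewrite mulrCA. Qed.

Lemma ExB f g : Ex (fun D => f D - g D) = Ex f - Ex g.
Proof.
rewrite ExD -[in RHS]mulN1r -ExZ; congr (_ + _).
by apply: eq_Ex => D; rewrite mulN1r.
Qed.

Lemma Ex_sum (T : Type) (s : seq T) (P : pred T) (f : T -> {set I} -> R) :
  Ex (fun D => \sum_(t <- s | P t) f t D) = \sum_(t <- s | P t) Ex (f t).
Proof.
rewrite /Ex exchange_big; apply: eq_bigr => D _; exact: mulr_sumr.
Qed.

Lemma Ex_exchange (f : {set I} -> {set I} -> R) :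
  Ex (fun D => Ex (f D)) = Ex (fun D' => Ex (f^~ D')).
Proof.
rewrite /Ex; under eq_bigr do rewrite mulr_sumr.
rewrite exchange_big; apply: eq_bigr => D' _; rewrite mulr_sumr.
by apply: eq_bigr => D _; rewrite mulrCA.
Qed.

Definition splice (A D D' : {set I}) : {set I} := (D :&: A) :|: (D' :\: A).

Lemma in_splice A D D' i :
  (i \in splice A D D') = if i \in A then i \in D else i \in D'.
Proof. by rewrite !inE; case: (i \in A); rewrite ?andbT ?andbF ?orbF. Qed.

(* Exchanging the outside parts of an independent pair (D, D') is an involution
   that preserves its joint law. *)
Lemma Ex_resample (A : {set I}) (f : {set I} -> R) :
  Ex f = Ex (fun D => Ex (fun D' => f (splice A D D'))).
Proof.
pose mu2 (u : {set I} * {set I}) := bern_mass u.1 * bern_mass u.2.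
have pairE g : Ex (fun D => Ex (g D)) = \sum_u mu2 u * g u.1 u.2.
  rewrite /Ex -(pair_bigA _ (fun D D' => mu2 (D, D') * g D D')) /=.
  apply: eq_bigr => D _; rewrite mulr_sumr; apply: eq_bigr => D' _.
  by rewrite mulrA.
transitivity (Ex (fun D => Ex (fun=> f D))).
  by apply: eq_Ex => D; rewrite Ex_const.
rewrite !pairE (reindex_inj (h := fun u => (splice A u.1 u.2, splice A u.2 u.1))) /=.
  apply: eq_bigr => -[D D'] _ /=; congr (_ * _).
  rewrite /mu2 /bern_mass -!big_split; apply: eq_bigr => i _ /=.
  by rewrite !in_splice; case: (i \in A); rewrite // mulrC.
apply: (can_inj (g := fun u => (splice A u.1 u.2, splice A u.2 u.1))).
by move=> [D D'] /=; congr (_, _); apply/setP => i; rewrite !in_splice; case: (i \in A).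
Qed.

(** After resampling outside [A], [f] sees only the first set and [g] only the second, so the double
    expectation splits. *)
Lemma Ex_indep (A B : {set I}) (f g : {set I} -> R) :
  [disjoint A & B] ->
  (forall D, f (D :&: A) = f D) -> (forall D, g (D :&: B) = g D) ->
  Ex (fun D => f D * g D) = Ex f * Ex g.
Proof.
move=> dAB fA gB; rewrite (Ex_resample A).
rewrite mulrC -ExZ; apply: eq_Ex => D; rewrite mulrC -ExZ; apply: eq_Ex => D'.
rewrite -fA -gB -[f D]fA -[g D']gB; congr (f _ * g _); apply/setP => i.
  by rewrite inE in_splice inE; case: (i \in A); rewrite ?andbF.
rewrite inE in_splice inE; have := disjointFr dAB (x := i).
by case: (i \in A) => // ->; rewrite ?andbF.
Qed.

(** One index is peeled off at a time: the remaining product depends only on the union of the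
    remaining [A j], which is disjoint from [A i]. *)
Lemma Ex_indep_prod (J : finType) (S : {set J}) (A : J -> {set I})
    (f : J -> {set I} -> R) :
  {in S &, forall i j, i != j -> [disjoint A i & A j]} ->
  (forall i D, i \in S -> f i (D :&: A i) = f i D) ->
  Ex (fun D => \prod_(i in S) f i D) = \prod_(i in S) Ex (f i).
Proof.
move=> dA fA; rewrite -[RHS]big_enum.
rewrite (eq_Ex (g := fun D => \prod_(i <- enum S) f i D));
  last by move=> D; rewrite big_enum.
have: {subset enum S <= S} by move=> i; rewrite mem_enum.
elim: (enum S) (enum_uniq S) => [_ _|i s IHs /= /andP[i_s us] sS].
  by rewrite (eq_Ex (g := fun=> 1)) ?Ex_const ?big_nil // => D; rewrite big_nil.
have iS : i \in S by apply: sS; rewrite inE eqxx.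
have sS' : {subset s <= S} by move=> j js; apply: sS; rewrite inE js orbT.
rewrite (eq_Ex (g := fun D => f i D * \prod_(j <- s) f j D));
  last by move=> D; rewrite big_cons.
rewrite (@Ex_indep (A i) (\bigcup_(j <- s) A j)) ?big_cons ?IHs //.
- rewrite disjoint_sym; apply/pred0P => k /=; apply/negP => /andP[kU ki].
  have [j js kj] : exists2 j, j \in s & k \in A j.
    elim: {IHs us sS sS' i_s} s kU => [|j s IHs]; rewrite ?big_nil ?big_cons !inE //.
    case/orP => [kj|/IHs[j' ? ?]]; first by exists j; rewrite ?inE ?eqxx.
    by exists j'; rewrite // inE; apply/orP; right.
  have ij : i != j by apply: contraNneq i_s => ->.
  by have /disjointFr/(_ ki) := dA _ _ iS (sS' _ js) ij; rewrite kj.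
- by move=> D; apply: fA.
move=> D; apply: eq_big_seq => j js.
rewrite -(fA _ _ (sS' _ js)) -[RHS](fA _ _ (sS' _ js)); congr (f j _).
rewrite -setIA; congr (_ :&: _); apply/setIidPr.
elim: {IHs us sS sS' i_s} s js => [//|k s IHs]; rewrite big_cons inE.
case/orP => [/eqP->|/IHs/subset_trans]; first exact: subsetUl.
by apply; apply: subsetUr.
Qed.

Hypothesis p01 : 0 <= p <= 1.

Lemma bern_ge0 b : 0 <= bern b.
Proof. by case/andP: p01 => p0 p1; case: b; rewrite //= subr_ge0. Qed.

Lemma bern_mass_ge0 D : 0 <= bern_mass D.
Proof. by apply: prodr_ge0 => i _; apply: bern_ge0. Qed.

Lemma le_Ex f g : (forall D, f D <= g D) -> Ex f <= Ex g.
Proof. by move=> fg; apply: ler_sum => D _; rewrite ler_wpM2l ?bern_mass_ge0. Qed.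

Lemma Ex_miss (a : {set I}) : Ex (fun D => [disjoint a & D]%:R) = (1 - p) ^+ #|a|.
Proof.
pose f i (b : bool) : R := if i \in a then (~~ b)%:R else 1.
transitivity (Ex (fun D => \prod_i f i (i \in D))).
  apply: eq_Ex => D; rewrite /f -big_mkcond /=.
  have [daD|] := boolP [disjoint a & D].
    by rewrite big1 // => i ia; rewrite (disjointFr daD ia).
  case/pred0Pn => i /= /andP[ia iD].
  by rewrite (bigD1 i) //= iD mul0r.
rewrite Ex_prod (bigID (mem a)) /= [X in _ * X]big1 ?mulr1; last first.
  by move=> i /negPf ia; rewrite /f ia !mulr1 addrC subrK.
rewrite (eq_bigr (fun=> 1 - p)) ?prodr_const // => i ia.
by rewrite /f ia mulr0 add0r mulr1.
Qed.

Lemma hit_prob_ge0 n : 0 <= 1 - (1 - p) ^+ n.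
Proof.
by case/andP: p01 => p0 p1; rewrite subr_ge0 exprn_ile1 // ?subr_ge0 // lerBlDr lerDl.
Qed.

(* Harris inequality for the increasing events "D meets a": given that D misses
   a, the other events are governed by D :\: a, a subset of D. *)
Lemma Ex_all_hit_ge (s : seq {set I}) :
  \prod_(a <- s) (1 - (1 - p) ^+ #|a|)
  <= Ex (fun D => (all (fun a : {set I} => ~~ [disjoint a & D]) s)%:R).
Proof.
elim: s => [|a s IHs]; first by rewrite big_nil Ex_const.
rewrite big_cons; set e := (X in _ <= Ex X).
apply: le_trans (ler_wpM2l (hit_prob_ge0 _) IHs) _.
have -> : Ex e = Ex (fun D => (all (fun a : {set I} => ~~ [disjoint a & D]) s)%:R)
   - Ex (fun D => [disjoint a & D]%:R
       * (all (fun a : {set I} => ~~ [disjoint a & D]) s)%:R).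
  rewrite -[X in _ - X]mul1r -mulNr -ExZ -ExD; apply: eq_Ex => D.
  rewrite /e /=; case: [disjoint a & D] => /=; last by rewrite mul0r mulr0 addr0.
  by rewrite mul1r mulN1r subrr.
rewrite mulrBl mul1r lerD2l lerN2 [leLHS](Ex_resample a).
rewrite -Ex_miss [leRHS]mulrC -ExZ; apply: le_Ex => D.
rewrite [leRHS]mulrC -ExZ; apply: le_Ex => D'.
have -> : [disjoint a & splice a D D'] = [disjoint a & D].
  rewrite -!setI_eq0; congr (_ == _); apply/setP => i.
  by rewrite inE in_splice inE; case: (i \in a).
have [daD|_] := boolP [disjoint a & D]; last by rewrite !mul0r.
rewrite !mul1r ler_nat; case: allP => // hit; rewrite lt0b.
apply/allP => b /hit; apply: contra => dbD'.
apply: disjointWr dbD'; apply/subsetP => i.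
rewrite in_splice; case: ifP => // ia iD.
by have := disjointFr daD ia; rewrite iD.
Qed.

(** At most one trace on [K] satisfies [h], and its probability is a product over [K] of factors [p]
    or [1 - p], all at most [1 - p]. *)
Lemma Ex_unique_le (K : {set I}) (h : pred {set I}) :
  p <= 1 - p ->
  (forall D D', h (D :&: K) -> h (D' :&: K) -> D :&: K = D' :&: K) ->
  Ex (fun D => (h (D :&: K))%:R) <= (1 - p) ^+ #|K|.
Proof.
move=> pq huniq; have [D0 hD0|h0] := pickP (fun D => h (D :&: K)); last first.
  rewrite (eq_Ex (g := fun=> 0)) ?Ex_const; last by move=> D; rewrite h0.
  by rewrite exprn_ge0 // (bern_ge0 false).
pose f i (b : bool) : R := if i \in K then (b == (i \in D0))%:R else 1.
apply: (@le_trans _ _ (Ex (fun D => \prod_i f i (i \in D)))).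
  apply: le_Ex => D; have [hD|_] := boolP (h (D :&: K)); last first.
    by apply: prodr_ge0 => i _; rewrite /f; case: ifP.
  rewrite big1 // => i _; rewrite /f; case: ifP => // iK.
  by have /setP/(_ i) := huniq _ _ hD hD0; rewrite !inE iK !andbT => ->; rewrite eqxx.
rewrite Ex_prod (bigID (mem K)) /= [X in _ * X]big1 ?mulr1; last first.
  by move=> i /negPf iK; rewrite /f iK !mulr1 addrC subrK.
rewrite -prodr_const; apply: ler_prod => i iK; rewrite /f iK.
by case: (i \in D0) => /=; rewrite mulr0 mulr1 ?addr0 ?add0r
  ?(bern_ge0 true) ?(bern_ge0 false) ?pq /=.
Qed.
End BernoulliSets.

(** * Logarithmic inequalities *)

Section LogBounds.
Variable R : realType.
Implicit Types u v x p : R.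

Lemma ln_le_sub1 x : 0 < x -> ln x <= x - 1.
Proof.
by move=> x0; have := @le_ln1Dx R (x - 1); rewrite [1 + _]addrC subrK; apply; lra.
Qed.

(* Concavity of ln on [u, 1]: with v = 1 - u, v = (u / v) * u + (1 - u / v) * 1. *)
Lemma xlnx_le_compl u : 0 < u -> u <= 1 / 2 -> u * ln u <= (1 - u) * ln (1 - u).
Proof.
move=> u0 u2; have v0 : 0 < 1 - u by lra.
have := ln_le_sub1 (divr_gt0 u0 v0); rewrite ln_div ?posrE // => h1.
have := ln_le_sub1 (divr_gt0 (@ltr01 R) v0); rewrite ln_div ?posrE // ln1 => h2.
have k1 : u * (ln u - ln (1 - u)) <= u * (u / (1 - u) - 1) by rewrite ler_wpM2l // ltW.
have k2 : (1 - 2 * u) * (0 - ln (1 - u)) <= (1 - 2 * u) * (1 / (1 - u) - 1).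
  by rewrite ler_wpM2l //; lra.
have e : u * (u / (1 - u) - 1) + (1 - 2 * u) * (1 / (1 - u) - 1) = 0.
  by field; rewrite gt_eqF.
lra.
Qed.

(** By [xlnx_le_compl] the derivative of [ln x * ln (1 - x)] is nonnegative up to 1/2, where the
    value is the right-hand side. *)
Lemma ln_mul_ln_compl_half u : 0 < u -> u <= 1 / 2 ->
  ln u * ln (1 - u) <= ln (2 : R) ^+ 2.
Proof.
move=> u0 u2.
pose f x : R := ln x * ln (1 - x).
pose df x : R := ln x * ((1 - x)^-1 * (0 - 1)) + ln (1 - x) * x^-1.
have fE : f = (@ln R * (@ln R \o (cst 1 - id)))%R by [].
have fd x : 0 < x -> x < 1 -> is_derive x 1 f (df x).
  move=> x0 x1; rewrite fE; have d1 := is_derive1_ln x0.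
  have d2 : is_derive x 1 (@ln R \o (cst 1 - id)) ((1 - x)^-1 * (0 - 1)).
    by apply: is_derive1_comp; apply: is_derive1_ln; rewrite subr_gt0.
  exact: is_deriveM.
have [| |c c2 E] := @MVT_segment R f df u (1 / 2) u2.
- by move=> x; rewrite in_itv /= => /andP[ux x2]; apply: fd; lra.
- apply: derivable_within_continuous => x; rewrite in_itv /= => /andP[ux x2].
  by apply: (@ex_derive _ _ _ _ _ _ (df x)); apply: fd; lra.
move: c2; rewrite in_itv /= => /andP[uc c2].
have c0 : 0 < c by lra.
have c1 : 0 < 1 - c by lra.
have dfc : 0 <= df c.
  have -> : df c = ((1 - c) * ln (1 - c) - c * ln c) / (c * (1 - c)).
    by rewrite /df; field; rewrite !gt_eqF.
  apply: divr_ge0; last by rewrite mulr_ge0 // ltW.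
  by rewrite subr_ge0 xlnx_le_compl.
have f2 : f (1 / 2) = ln 2 ^+ 2.
  have h : 1 - 1 / 2 = 1 / 2 :> R by lra.
  by rewrite /f h ln_div ?posrE // ln1 sub0r expr2 mulrNN.
rewrite -f2 -subr_ge0 -/(f u) E mulr_ge0 // subr_ge0 //.
Qed.

Lemma ln_mul_ln_compl u : 0 < u < 1 -> ln u * ln (1 - u) <= ln (2 : R) ^+ 2.
Proof.
move=> /andP[u0 u1]; have [u2|u2] := leP u (1 / 2).
  exact: ln_mul_ln_compl_half.
have -> : ln u * ln (1 - u) = ln (1 - u) * ln (1 - (1 - u)).
  by rewrite subKr mulrC.
by apply: ln_mul_ln_compl_half; lra.
Qed.

(* With u = 1 - (1 - p)^(w + 1) one has w + 1 <= - ln (1 - u) / p. *)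
Lemma test_cost_le p (w : nat) : 0 < p < 1 ->
  w.+2%:R * - ln (1 - (1 - p) ^+ w.+1) <= ln (2 : R) ^+ 2 / p - ln p.
Proof.
move=> /andP[p0 p1]; have q0 : 0 < 1 - p by lra.
set u := 1 - (1 - p) ^+ w.+1.
have qw0 : 0 < (1 - p) ^+ w.+1 by rewrite exprn_gt0.
(* The extra unit in [w.+2] costs one more [- ln u]; this bound turns it into the correction
   [- ln p]. *)
have pu : p <= u.
  rewrite /u exprS; have : (1 - p) * (1 - p) ^+ w <= (1 - p) * 1.
    by rewrite ler_wpM2l ?exprn_ile1 //; lra.
  lra.
have u1 : u < 1 by rewrite /u; lra.
have u0 : 0 < u by lra.
have lup : - ln u <= - ln p by rewrite lerN2 ler_ln ?posrE.
rewrite -natr1 mulrDl mul1r; apply: lerD lup.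
have u01 : 0 < u < 1 by rewrite u0.
rewrite ler_pdivlMr //; apply: (le_trans _ (ln_mul_ln_compl u01)).
have -> : ln u * ln (1 - u) = - ln u * (w.+1%:R * - ln (1 - p)).
  by rewrite /u subKr lnXn // mulrN mulrNN mulr_natl.
rewrite mulrAC mulrC; apply: ler_wpM2l; first by rewrite oppr_ge0 ln_le0 // ltW.
rewrite ler_wpM2l //; have := ln_le_sub1 q0; lra.
Qed.
End LogBounds.

Lemma ln_le_linear (R : realType) (k : R) : 0 < k ->
  exists x0 : R, forall x, 0 < x -> x0 <= x -> ln x <= k * x.
Proof.
move=> k0; exists (- ln (k / 2) / (k / 2)) => x xp.
have k2 : 0 < k / 2 by rewrite divr_gt0.
rewrite ler_pdivrMr // => h1.
have := ln_le_sub1 (mulr_gt0 k2 xp); rewrite (lnM (x := k / 2)) ?posrE // => h2.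
have e : k * x = k / 2 * x + x * (k / 2) by lra.
rewrite e; lra.
Qed.

(** The Taylor term of degree [k.+1] alone dominates once [x] exceeds [A] times the factorial of
    [k.+1]. *)
Lemma expR_ge_monomial (R : realType) (A : R) (k : nat) :
  exists x0 : R, forall x, 0 <= x -> x0 <= x -> A * x ^+ k <= expR x.
Proof.
exists (A * k.+1`!%:R) => x x0 Ax; apply: le_trans (expR_ge1Dxn k x0).
apply: (@le_trans _ _ (x ^+ k.+1 / k.+1`!%:R)); last by rewrite lerDr.
have f0 : 0 < k.+1`!%:R :> R by rewrite ltr0n fact_gt0.
by rewrite ler_pdivlMr // mulrAC exprS ler_wpM2r // exprn_ge0.
Qed.

Lemma expRN_lt (R : realType) (e x : R) : 0 < e -> 1 / e <= x -> expR (- x) < e.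
Proof.
move=> e0 ex; rewrite expRN invf_plt ?posrE ?expR_gt0 //.
have := expR_ge1Dx x; rewrite -div1r; lra.
Qed.

(** * Masked items *)

Section Masking.
Variables (R : realType) (n : nat) (tests : seq {set 'I_n}).
Variables (small : pred {set 'I_n}) (V : {set 'I_n}).
Implicit Types (i j k : 'I_n) (a D Y S : {set 'I_n}).

(** Phrased as hitting every set of a list, so that [Ex_all_hit_ge] applies directly. *)
Definition masked i Y : bool :=
  all (fun a : {set 'I_n} => ~~ [disjoint a & Y])
    [seq (a :&: V) :\ i | a <- tests & small a && (i \in a)].

Definition reach i : {set 'I_n} :=
  [set k | (k == i) || has (fun a => [&& small a, i \in a & k \in a :&: V]) tests].

Lemma reachP i k :
  reflect (k = i \/ exists a, [/\ a \in tests, small a, i \in a & k \in a :&: V])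
          (k \in reach i).
Proof.
rewrite inE; apply: (iffP orP) => -[].
- by move=> /eqP->; left.
- by case/hasP => a ta /and3P[*]; right; exists a.
- by move=> ->; left.
by case=> a [ta sa ia ka]; right; apply/hasP; exists a; rewrite // sa ia.
Qed.

Lemma reachxx i : i \in reach i.
Proof. by apply/reachP; left. Qed.

Lemma maskedP i Y :
  reflect (forall a, a \in tests -> small a -> i \in a ->
             exists j, [/\ j \in a :&: V, j != i & j \in Y])
          (masked i Y).
Proof.
rewrite /masked all_map; apply: (iffP allP) => h a.
  move=> ta sa ia; have := h a; rewrite mem_filter sa ia ta => /(_ isT)/pred0Pn[j /=].
  by rewrite in_setD1 => /andP[/andP[? ?] ?]; exists j.
rewrite mem_filter => /andP[/andP[sa ia] ta]; have [j [ja ji jY]] := h a ta sa ia.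
by apply/pred0Pn; exists j; rewrite /= in_setD1 ji ja.
Qed.

(** Locality: this makes the masking events of items with disjoint reaches independent. *)
Lemma masked_reach i D : masked i (D :&: (reach i :\ i)) = masked i D.
Proof.
apply/maskedP/maskedP => h a ta sa ia; have [j [ja ji jD]] := h a ta sa ia.
  by exists j; split=> //; move: jD; rewrite inE => /andP[].
exists j; split=> //; rewrite inE jD in_setD1 ji.
by apply/reachP; right; exists a.
Qed.


Lemma test_outcomeE D a : test_outcome D a = ~~ [disjoint a & D].
Proof.
apply/existsP/pred0Pn => -[i /=]; first by case/andP => ia iD; exists i; rewrite /= ia.
by case/andP => ia iD; exists i; rewrite ia.
Qed.

Lemma success_probE (p : R) dec :
  success_prob p tests dec = Ex p (fun D => (dec (outcomes tests D) == D)%:R).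
Proof. by apply: eq_bigr => D _; rewrite bern_massE card_ord. Qed.

(* Fix the items outside S. The masked items of S can then be flipped freely
   without changing any outcome (large tests being positive anyway), so that at
   most one of their configurations is decoded correctly. *)
Lemma success_prob_le (p : R) dec S : 0 <= p <= 1 -> p <= 1 - p ->
  {in S &, forall i j, i != j -> [disjoint reach i & reach j]} ->
  success_prob p tests dec <=
    \sum_(a <- tests | ~~ small a) (1 - p) ^+ #|a|
    + \prod_(i in S) (1 - p * Ex p (fun Y => (masked i Y)%:R)).
Proof.
move=> p01 pq dS; rewrite success_probE.
(* [good] says that all large tests are positive; its failure is paid for by a union bound, the
   first sum of the statement. *)
pose good D := all (fun a => small a || ~~ [disjoint a & D]) tests.
pose ok D := good D && (dec (outcomes tests D) == D).
apply: (@le_trans _ _ (Ex p (fun D =>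
    \sum_(a <- tests | ~~ small a) [disjoint a & D]%:R + (ok D)%:R))).
  apply: le_Ex => // D; rewrite /ok; have [gD|/allPn[a ta]] := boolP (good D).
    by rewrite lerDr sumr_ge0.
  rewrite negb_or negbK => /andP[la daD] /=; rewrite addr0.
  rewrite (big_rem a) //= la daD; case: eqP => _; last by rewrite addr_ge0 // sumr_ge0.
  by rewrite lerDl sumr_ge0.
rewrite ExD Ex_sum; apply: lerD.
  by apply: ler_sum => a _; rewrite Ex_miss.
have BS i j : i \in S -> j \in reach i -> j != i -> j \notin S.
  move=> iS jb ji; apply/negP => jS.
  by have /disjointFr/(_ (reachxx j)) := dS _ _ jS iS ji; rewrite jb.
pose K Y := [set i in S | masked i Y].
apply: (@le_trans _ _ (Ex p (fun Y => (1 - p) ^+ #|K Y|))); last first.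
  pose f i Y : R := 1 - p * (masked i Y)%:R.
  rewrite (eq_Ex _ (g := fun Y => \prod_(i in S) f i Y)); last first.
    move=> Y; rewrite -prodr_const [RHS](bigID (fun i => masked i Y)) /=.
    rewrite [X in _ * X]big1 ?mulr1; last first.
      by move=> i /andP[_ /negPf mi]; rewrite /f mi mulr0 subr0.
    apply: eq_big => i; first by rewrite inE.
    by rewrite inE => /andP[_ mi]; rewrite /f mi mulr1.
  rewrite (@Ex_indep_prod _ _ _ _ _ (fun i => reach i :\ i)).
  - rewrite le_eqVlt; apply/predU1P; left; apply: eq_bigr => i _.
    by rewrite /f ExB ExZ Ex_const.
  - move=> i j iS jS ij; apply: disjointWl (subsetDl _ _) _.
    by apply: disjointWr (subsetDl _ _) _; apply: dS.
  by move=> i D _; rewrite /f masked_reach.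
rewrite (Ex_resample p S) Ex_exchange; apply: le_Ex => // Y.
have KS : K Y \subset S by apply/subsetP => i; rewrite inE => /andP[].
(* After both resamplings the defective set follows a fresh set on [K Y], [Z] on the rest of [S] and
   [Y] outside [S]; only the first still varies. *)
rewrite (Ex_resample p (K Y)) Ex_exchange -[leRHS](@Ex_const _ 'I_n p).
apply: le_Ex => // Z.
pose Rest := splice S Z Y :\: K Y.
pose h D := ok (D :|: Rest).
rewrite (eq_Ex _ (g := fun D => (h (D :&: K Y))%:R)); last first.
  move=> D; rewrite /h; congr (_ (ok _))%:R; apply/setP => i.
  rewrite !in_splice; have := subsetP KS i.
  by case: (i \in K Y) => [-> //|_]; case: (i \in S).
apply: Ex_unique_le => // D D' /andP[gD /eqP eD] /andP[gD' /eqP eD'].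
suff eq_out : outcomes tests (D :&: K Y :|: Rest) = outcomes tests (D' :&: K Y :|: Rest).
  have := congr1 (fun X => X :&: K Y) (etrans (esym eD) (etrans (congr1 dec eq_out) eD')).
  suff cut X : (X :&: K Y :|: Rest) :&: K Y = X :&: K Y by rewrite !cut.
  by apply/setP => i; rewrite !in_setI in_setU in_setI in_setD; case: (i \in K Y);
    rewrite ?andbT ?orbF ?andbF.
apply/eq_in_map => a ta; rewrite !test_outcomeE.
have [sa|la] := boolP (small a); last first.
  by have := allP gD a ta; have := allP gD' a ta; rewrite (negPf la) /= => -> ->.
have [daK|/pred0Pn[i /= /andP[ia iK]]] := boolP [disjoint a & K Y].
  rewrite -!setI_eq0; congr (~~ (_ == _)); apply/setP => i.
  have := disjointFr daK (x := i); rewrite !in_setI !in_setU !in_setI.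
  by case: (i \in a) => // ->; rewrite ?andbF.
(* The defective item that masks [i] in [a] lies outside [S], hence in [Rest], whatever happens on
   [K Y]. *)
have hit X : ~~ [disjoint a & X :&: K Y :|: Rest].
  move: (iK); rewrite inE => /andP[iS /maskedP/(_ a ta sa ia)[j [jaV ji jY]]].
  have jS : j \notin S by apply: BS iS _ ji; apply/reachP; right; exists a.
  apply/pred0Pn; exists j => /=; move: jaV; rewrite inE => /andP[-> _] /=.
  rewrite in_setU in_setD in_splice (negPf jS) jY andbT.
  by rewrite (contra (subsetP KS j)) ?orbT.
by rewrite !hit.
Qed.
End Masking.

(** * Counting items *)

Lemma card_has_le (T : Type) (I : finType) (s : seq T) (P : T -> pred I) :
  (#|[set k | has (P^~ k) s]| <= \sum_(a <- s) #|[set k | P a k]|)%N.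
Proof.
elim: s => [|a s IHs].
  by rewrite big_nil leqn0 cards_eq0; apply/eqP/setP => k; rewrite !inE.
rewrite big_cons; apply: leq_trans (leq_add (leqnn _) IHs).
have -> : [set k | has (P^~ k) (a :: s)] = [set k | P a k] :|: [set k | has (P^~ k) s].
  by apply/setP => k; rewrite !inE.
exact: leq_card_setU.
Qed.

Lemma sumr_const_count (R : pzRingType) (T : Type) (s : seq T) (P : pred T) (x : R) :
  \sum_(a <- s | P a) x = (count P s)%:R * x.
Proof. by rewrite -sum1_count natr_sum mulr_suml; apply: eq_bigr => a _; rewrite mul1r. Qed.

Lemma card_bigcup_le (R : numDomainType) (I J : finType) (A : {set J})
    (F : J -> {set I}) (c : R) :
  {in A, forall i, #|F i|%:R <= c} -> #|\bigcup_(i in A) F i|%:R <= #|A|%:R * c.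
Proof.
move=> Fc; apply: (@le_trans _ _ (\sum_(i in A) #|F i|%:R)).
  rewrite -natr_sum ler_nat.
  elim/big_rec2: _ => [|i m X _ h]; first by rewrite cards0.
  by apply: leq_trans (leq_card_setU _ _) _; rewrite leq_add2l.
by apply: le_trans (ler_sum _ Fc) _; rewrite sumr_const mulr_natl.
Qed.

Section Counting.
Variables (R : realType) (n : nat) (tests : seq {set 'I_n}).
Variables (small : pred {set 'I_n}) (V : {set 'I_n}) (w d p : R).
Implicit Types (i j k : 'I_n) (a G S : {set 'I_n}).

Local Notation reach := (reach tests small V).
Local Notation T := (size tests).

Definition deg i : nat := count (fun a => small a && (i \in a)) tests.

Hypothesis w0 : 0 <= w.
Hypothesis smallw : forall a, small a -> #|a|%:R <= w.
Hypothesis degV : forall i, i \in V -> (deg i)%:R <= d.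

Lemma card_reach_le i : i \in V -> #|reach i|%:R <= 1 + d * w.
Proof.
move=> iV; pose P a k := [&& small a, i \in a & k \in a :&: V].
have -> : reach i = i |: [set k | has (P^~ k) tests] by apply/setP => k; rewrite !inE.
apply: (@le_trans _ _ (1 + (\sum_(a <- tests) #|[set k | P a k]|)%N%:R)).
  by rewrite -(natrD _ 1) ler_nat cardsU1 leq_add ?leq_b1 ?card_has_le.
rewrite lerD2l natr_sum (bigID (fun a => small a && (i \in a))) /=.
rewrite [X in _ + X]big1 ?addr0; last first.
  move=> a h; rewrite (_ : [set k | P a k] = set0) ?cards0 //.
  by apply/setP => k; rewrite !inE /P andbA (negPf h).
apply: (@le_trans _ _ (\sum_(a <- tests | small a && (i \in a)) w)).
  apply: ler_sum => a /andP[sa ia]; apply: le_trans (smallw sa).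
  rewrite ler_nat subset_leq_card //; apply/subsetP => k; rewrite inE => /and3P[_ _].
  by rewrite inE => /andP[].
by rewrite sumr_const_count ler_wpM2r ?degV.
Qed.

Lemma reach_subV i : i \in V -> reach i \subset V.
Proof.
by move=> iV; apply/subsetP => k /reachP[->//|[a [_ _ _]]]; rewrite inE => /andP[].
Qed.

Lemma reach_sym i k : i \in V -> k \in reach i -> i \in reach k.
Proof.
move=> iV /reachP[->|[a [ta sa ia]]]; first exact: reachxx.
by rewrite inE => /andP[ka _]; apply/reachP; right; exists a; split; rewrite // inE ia.
Qed.

(** Take [S] maximal for inclusion. Each item of [G] then has a reach meeting that of some item of
    [S], so it lies within two reach steps of [S]; each two-step ball has at most [(1 + d * w) ^+ 2]
    items. *)
Lemma exists_scattered G : G \subset V -> exists S : {set 'I_n},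
  [/\ S \subset G, {in S &, forall i j, i != j -> [disjoint reach i & reach j]}
    & #|G|%:R <= #|S|%:R * (1 + d * w) ^+ 2].
Proof.
move=> GV; pose scat (S : {set 'I_n}) := (S \subset G) &&
  [forall i in S, forall j in S, (i != j) ==> [disjoint reach i & reach j]].
have scatP S : scat S -> {in S &, forall i j, i != j -> [disjoint reach i & reach j]}.
  by case/andP => _ /'forall_in_'forall_in_implyP h i j iS jS; apply: h.
have scat0 : exists S, scat S.
  by exists set0; rewrite /scat sub0set; apply/forall_inP => i; rewrite inE.
have [S /maxsetP[scS Smax]] := ex_maxset scat0.
have SG : S \subset G by case/andP: scS.
exists S; split=> //; first exact: scatP.
pose U i := \bigcup_(k in reach i) reach k.
have cover : G \subset \bigcup_(i in S) U i.
  apply/subsetP => j jG; apply/bigcupP.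
  have jV := subsetP GV j jG.
  have [/exists_inP[i iS /pred0Pn[k /= /andP[ki kj]]]|] :=
      boolP [exists i in S, ~~ [disjoint reach i & reach j]].
    by exists i => //; apply/bigcupP; exists k => //; apply: reach_sym.
  rewrite negb_exists_in => /forall_inP dj; exists j.
    suff <- : j |: S = S by rewrite setU11.
    apply: Smax; last exact: subsetUr.
    rewrite /scat subUset sub1set jG SG; apply/forall_inP => x xS.
    apply/forall_inP => y yS; apply/implyP => xy.
    move: xS yS; rewrite !in_setU1 => /predU1P[xj|xS] /predU1P[yj|yS].
    - by rewrite xj yj eqxx in xy.
    - by rewrite xj disjoint_sym; have := dj y yS; rewrite negbK.
    - by rewrite yj; have := dj x xS; rewrite negbK.
    exact: scatP scS _ _ xS yS xy.
  by apply/bigcupP; exists j; apply: reachxx.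
apply: (@le_trans _ _ #|\bigcup_(i in S) U i|%:R).
  by rewrite ler_nat subset_leq_card.
apply: card_bigcup_le => i iS; have iV := subsetP GV i (subsetP SG i iS).
apply: le_trans (card_bigcup_le (c := 1 + d * w) _) _.
  by move=> k ki; apply: card_reach_le; apply: (subsetP (reach_subV iV)).
rewrite expr2 ler_wpM2r ?card_reach_le //.
by apply: le_trans (card_reach_le iV).
Qed.

Definition unisolated : {set 'I_n} :=
  [set i in V | all (fun a => small a && (i \in a) ==> (1 < #|a :&: V|)%N) tests].

Lemma unisolated_card i a :
  i \in unisolated -> a \in tests -> small a -> i \in a -> (1 < #|a :&: V|)%N.
Proof. by rewrite inE => /andP[_ /allP h] ta sa ia; have := h a ta; rewrite sa ia. Qed.

(** Double counting of the pairs of a small test and an item in it. *)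
Lemma card_highdeg_le : (forall i, i \notin V -> d <= (deg i)%:R) ->
  #|~: V|%:R * d <= T%:R * w.
Proof.
move=> degVC; apply: (@le_trans _ _ (\sum_i (deg i)%:R)).
  rewrite (bigID (mem V)) /= -[leLHS]add0r lerD ?sumr_ge0 //.
  have -> : #|~: V|%:R * d = \sum_(i | i \notin V) d.
    rewrite sumr_const mulr_natl; congr (_ *+ _).
    by apply: eq_card => i; rewrite !inE.
  by apply: ler_sum => i; apply: degVC.
rewrite -natr_sum /deg; under eq_bigr do rewrite -sum1_count.
rewrite (exchange_big_dep small) /=; last by move=> i a _ /andP[].
rewrite natr_sum; apply: (@le_trans _ _ (\sum_(a <- tests | small a) w)).
  apply: ler_sum => a sa; apply: le_trans (smallw sa).
  rewrite ler_nat sum1_card; apply: subset_leq_card.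
  by apply/subsetP => i; rewrite unfold_in => /andP[].
by rewrite sumr_const_count ler_wpM2r // ler_nat count_size.
Qed.

(** Each discarded item is the only element of some [a :&: V], and a test can account for at most
    one such item. *)
Lemma card_isolated_le : (#|V :\: unisolated| <= T)%N.
Proof.
pose P a k := (k \in a :&: V) && (#|a :&: V| <= 1)%N.
apply: (@leq_trans #|[set k | has (P^~ k) tests]|).
  apply: subset_leq_card; apply/subsetP => i; rewrite in_setD => /andP[iF iV].
  move: iF; rewrite !inE iV /= => /allPn[a ta].
  rewrite negb_imply -leqNgt => /andP[/andP[_ ia] h].
  by apply/hasP; exists a; rewrite // /P inE ia iV.
apply: leq_trans (card_has_le _ _) _; rewrite -sum1_size; apply: leq_sum => a _.
have [le1|gt1] := leqP #|a :&: V| 1.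
  apply: leq_trans le1; apply: subset_leq_card.
  by apply/subsetP => k; rewrite inE => /andP[].
rewrite (_ : [set k | _] = set0) ?cards0 //; apply/setP => k.
by rewrite !inE /P leqNgt gt1 andbF.
Qed.

(** The predecessor leaves out the item to be masked. For [#|a :&: V| = 1] the argument of [ln] is 0
    and the default [ln 0 = 0] would be meaningless, whence the restriction to [unisolated]. *)
Definition test_cost a : R := - ln (1 - (1 - p) ^+ #|a :&: V|.-1).

Definition cost i : R := \sum_(a <- tests | small a && (i \in a)) test_cost a.

Hypothesis p01 : 0 < p < 1.

Lemma test_cost_ge0 a : 0 <= test_cost a.
Proof.
case/andP: p01 => p0 p1.
by rewrite oppr_ge0 ln_le0 // lerBlDr lerDl exprn_ge0 // subr_ge0 ltW.
Qed.

Lemma cost_ge0 i : 0 <= cost i.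
Proof. by apply: sumr_ge0 => a _; apply: test_cost_ge0. Qed.

(** Exchanging the sums charges the cost of [a] at most [#|a :&: V|] times, and [test_cost_le]
    bounds that product. *)
Lemma sum_cost_le :
  \sum_(i in unisolated) cost i <= T%:R * (ln (2 : R) ^+ 2 / p - ln p).
Proof.
set M := (X in _ * X).
have M0 : 0 <= M.
  by apply: le_trans (test_cost_le 0 p01); rewrite mulr_ge0 // oppr_ge0 ln_le0 //;
    case/andP: p01 => p0 p1; rewrite lerBlDr lerDl exprn_ge0 // subr_ge0 ltW.
rewrite (exchange_big_dep xpredT) //= -sum1_size natr_sum mulr_suml.
rewrite !big_seq; apply: ler_sum => a ta; rewrite mul1r sumr_const -mulr_natl.
set m := #|_|; have mV : (m <= #|a :&: V|)%N.
  apply: subset_leq_card; apply/subsetP => i; rewrite unfold_in => /and3P[iF _ ia].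
  by rewrite inE ia; move: iF; rewrite inE => /andP[].
have [m0|] := posnP m; first by rewrite m0 mul0r.
(* A test that is charged at all contains an unisolated item, so [a :&: V] has at least two
   elements, as the form [w.+2] in [test_cost_le] demands. *)
case/card_gt0P => i; rewrite unfold_in => /and3P[iF sa ia].
have gt1 := unisolated_card iF ta sa ia.
case cE: #|a :&: V| mV gt1 => [|[|c]] // mV _.
apply: le_trans (test_cost_le c p01); rewrite /test_cost cE.
by rewrite ler_wpM2r ?ler_nat //; have := test_cost_ge0 a; rewrite /test_cost cE.
Qed.

Lemma masked_prob_ge i : i \in unisolated ->
  expR (- cost i) <= Ex p (fun Y => (masked tests small V i Y)%:R).
Proof.
move=> iF; have p01' : 0 <= p <= 1 by case/andP: p01 => p0 p1; rewrite !ltW.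
apply: (le_trans _ (Ex_all_hit_ge p01'
  [seq (a :&: V) :\ i | a <- tests & small a && (i \in a)])).
rewrite big_map big_filter.
rewrite /cost -sumrN expR_sum big_seq_cond [leRHS]big_seq_cond.
rewrite le_eqVlt; apply/predU1P; left; apply: eq_bigr => a /andP[ta /andP[sa ia]].
have iV : i \in V by move: iF; rewrite inE => /andP[].
have := unisolated_card iF ta sa ia.
rewrite /test_cost opprK (cardsD1 i) inE ia iV add1n ltnS /= => c0.
rewrite lnK // posrE subr_gt0 exprn_ilt1 // ?lt0n_neq0 //; case/andP: p01 => p0 p1; lra.
Qed.

End Counting.

(** * The converse bound *)

(** The quantities subtracted from [n] count, in order, the items of high degree, the isolated items
    and those of cost above [c]. What is left is thinned to a scattered set, each item of which
    contributes a factor at most [1 - p * expR (- c)]. *)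
Lemma success_prob_le_finite (R : realType) (n : nat) (tests : seq {set 'I_n})
    (dec : seq bool -> {set 'I_n}) (p w d c : R)
    (T := (size tests)%:R : R) (M := ln (2 : R) ^+ 2 / p - ln p) :
  0 < p -> p <= 1 / 2 -> 0 <= w -> 0 < d -> 0 < c ->
  success_prob p tests dec <= T * expR (- (p * w))
    + expR (- (p * expR (- c) * ((n%:R - T * w / d - T - T * M / c) / (1 + d * w) ^+ 2))).
Proof.
move=> p0 p2 w0 d0 c0.
pose small (a : {set 'I_n}) := #|a|%:R <= w.
pose V := [set i | (deg tests small i)%:R <= d].
have smallw a : small a -> #|a|%:R <= w by [].
have degV i : i \in V -> (deg tests small i)%:R <= d by rewrite inE.
have degVC i : i \notin V -> d <= (deg tests small i)%:R by rewrite inE -ltNge => /ltW.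
have p01 : 0 < p < 1 by rewrite p0; lra.
have p01' : 0 <= p <= 1 by case/andP: p01 => *; rewrite !ltW.
have expp : 1 - p <= expR (- p) by apply: expR_ge1Dx.
pose F := unisolated tests small V.
pose G := [set i in F | cost tests small V p i <= c].
have FV : F \subset V by apply/subsetP => i; rewrite inE => /andP[].
have GF : G \subset F by apply/subsetP => i; rewrite inE => /andP[].
have [S [SG dS cS]] := exists_scattered w0 smallw degV (subset_trans GF FV).
apply: le_trans (success_prob_le dec p01' _ dS) _; first by lra.
apply: lerD.
  apply: (@le_trans _ _ (\sum_(a <- tests | ~~ small a) expR (- (p * w)))).
    apply: ler_sum => a; rewrite -ltNge => /ltW wa.
    apply: (@le_trans _ _ (expR (- p) ^+ #|a|)).
      by rewrite lerXn2r // ?nnegrE ?expR_ge0 //; lra.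
    by rewrite -expRM_natl ler_expR mulrN lerN2 [leRHS]mulrC ler_pM2l.
  by rewrite sumr_const_count ler_wpM2r ?expR_ge0 // ler_nat count_size.
have nG : n%:R - T * w / d - T - T * M / c <= #|G|%:R.
  have c1 : #|~: V|%:R <= T * w / d by rewrite ler_pdivlMr // (card_highdeg_le w0 smallw).
  have c2 : #|V :\: F|%:R <= T by rewrite ler_nat card_isolated_le.
  (* Markov's inequality for the cost. *)
  have c3 : #|F :\: G|%:R <= T * M / c.
    rewrite ler_pdivlMr //; apply: le_trans (sum_cost_le tests small V p01).
    rewrite mulr_natl -sumr_const [leRHS](big_setID G) /= -[leLHS]add0r lerD //.
      by apply: sumr_ge0 => i _; apply: cost_ge0.
    apply: ler_sum => i; rewrite in_setD => /andP[iG iF]; move: iG.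
    by rewrite /G in_set iF -ltNge => /ltW.
  have -> : n%:R = #|~: V|%:R + (#|V :\: F|%:R + (#|F :\: G|%:R + #|G|%:R)) :> R.
    rewrite -!natrD; congr _%:R.
    rewrite -[in LHS](card_ord n) -(cardsC V) addnC; congr (_ + _)%N.
    rewrite -(cardsID F V) (setIidPr FV) addnC; congr (_ + _)%N.
    by rewrite -(cardsID G F) (setIidPr GF) addnC.
  lra.
pose x := p * expR (- c).
have x0 : 0 <= x by rewrite mulr_ge0 ?expR_ge0 ?ltW.
apply: (@le_trans _ _ (\prod_(i in S) expR (- x))).
  apply: ler_prod => i iS; have iG := subsetP SG i iS.
  have iF := subsetP GF i iG.
  have Pge : expR (- c) <= Ex p (fun Y => (masked tests small V i Y)%:R).
    apply: le_trans (masked_prob_ge p01 iF).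
    by rewrite ler_expR lerN2; move: iG; rewrite inE => /andP[].
  have Ple : Ex p (fun Y => (masked tests small V i Y)%:R) <= 1.
    rewrite -[leRHS](@Ex_const R 'I_n p); apply: le_Ex => // Y.
    by case: (masked _ _ _ _ _).
  apply/andP; split.
    rewrite subr_ge0; apply: le_trans (_ : p * 1 <= 1); last lra.
    by rewrite ler_wpM2l // ltW.
  apply: le_trans (expR_ge1Dx _); rewrite lerD2l lerN2 /x.
  by rewrite ler_wpM2l // ltW.
rewrite prodr_const -expRM_natl ler_expR mulrN lerN2 [leRHS]mulrC.
rewrite -/x ler_wpM2l // ler_pdivrMr; first exact: le_trans cS.
by rewrite exprn_gt0 // ltr_wpDr // mulr_ge0 // ltW.
Qed.

(* Error probability = 1 - success_prob; "error probability 1 - o(1)"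
   uniformly over all designs with T <= bound and all decoders means:
   the supremum of success_prob tends to 0. *)
Theorem theorem3 (R : realType) (lam eps : R) :
  0 < lam -> 0 < eps -> eps < 1 ->
  forall delta : R, 0 < delta ->
  exists n0 : nat, forall n : nat, (n0 < n)%N ->
  forall tests : seq {set 'I_n},
    (size tests)%:R <= (1 - eps) * (lam / (lam + (ln (2 : R)) ^+ 2)) * n%:R ->
  forall dec : seq bool -> {set 'I_n},
    @success_prob R n (lam / ln (n%:R : R)) tests dec < delta.
Proof.
move=> lam0 eps0 eps1 delta delta0.
set s := ln (2 : R) ^+ 2.
have s0 : 0 < s by rewrite exprn_gt0 // ln_gt0 // ltr1n.
(* Used at [x = l / lam], the inverse of [p], to make [- ln p] small against [s / p]. *)
have [x0 hx0] := ln_le_linear (k := eps / 4 * s) ltac:(by rewrite mulr_gt0 // divr_gt0).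
pose B := 1 / (delta / 2).
have B0 : 0 < B by rewrite /B !divr_gt0.
(* Chosen so that, for [y = eps / 4 * l], the product [lam * (eps / 4) / l * (A * y ^+ 15)] equals
   [B * (4 * l ^+ 14)]. The power 14 comes from the squared reach bound, one more from
   [p = lam / l]. *)
pose A := B * 4 / (lam * (eps / 4)) / (eps / 4) ^+ 15.
have [y0 hy0] := expR_ge_monomial A 15.
(* A sum of nonnegative thresholds, so that [l0 <= l] implies all of them at once. *)
pose l0 := 1 + 2 * lam + lam * `|x0| + 4 / eps + 2 / lam + B + `|y0| / (eps / 4).
have lp1 : 0 < 4 / eps by rewrite divr_gt0.
have lp2 : 0 < 2 / lam by rewrite divr_gt0.
have lp3 : 0 <= `|y0| / (eps / 4) by rewrite divr_ge0 // divr_ge0 // ltW.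
have lp4 : 0 <= lam * `|x0| by rewrite mulr_ge0 // ltW.
exists (Num.bound (expR l0)) => n n0n tests Tn dec.
have nl : expR l0 < n%:R.
  by apply: lt_trans (archi_boundP (expR_ge0 _)) _; rewrite ltr_nat.
have np : 0 < n%:R :> R by apply: lt_trans nl; apply: expR_gt0.
set l : R := ln n%:R.
have el : expR l = n%:R by rewrite lnK // posrE.
have ll0 : l0 <= l by rewrite -ler_expR el ltW.
have [l1 l2lam lx0 leps llam] : [/\ 1 <= l, 2 * lam <= l, lam * `|x0| <= l,
    4 / eps <= l & 2 / lam <= l] by move: ll0; rewrite /l0 => ll0; split; lra.
have [lB ly0] : B <= l /\ `|y0| / (eps / 4) <= l.
  by move: ll0; rewrite /l0 => ll0; split; lra.
have lp : 0 < l by lra.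
have ln0 : l != 0 by rewrite gt_eqF.
have lam0' : lam != 0 by rewrite gt_eqF.
pose T : R := (size tests)%:R; rewrite -/T in Tn.
have T0 : 0 <= T by rewrite ler0n.
have Tbnd : T * (1 + s / lam) <= (1 - eps) * n%:R.
  have h : 0 < 1 + s / lam by rewrite addr_gt0 // divr_gt0.
  rewrite -ler_pdivlMr //; apply: le_trans Tn _.
  rewrite le_eqVlt; apply/predU1P; left; field.
  by rewrite lam0' gt_eqF // addr_gt0.
have Tn1 : T <= n%:R.
  apply: le_trans (_ : T * (1 + s / lam) <= _);
    last by apply: le_trans Tbnd _; rewrite ler_piMl //; lra.
  by rewrite ler_peMr // lerDl divr_ge0 // ltW.
set p := lam / l.
have p0 : 0 < p by rewrite divr_gt0.
have p2 : p <= 1 / 2 by rewrite ler_pdivrMr //; lra.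
(* With this threshold [expR (- c)] is [n] to the power [eps / 4 - 1], so [n * expR (- c)] still
   grows as a power of [n]. *)
pose c := (1 - eps / 4) * l.
have c0 : 0 < c by rewrite mulr_gt0 //; lra.
apply: le_lt_trans
  (@success_prob_le_finite R n tests dec p (l ^+ 3) (l ^+ 4) c p0 p2 _ _ c0) _.
- by rewrite exprn_ge0 // ltW.
- by rewrite exprn_gt0.
rewrite -/T -/s.
have -> : delta = delta / 2 + delta / 2 by lra.
have d2 : 0 < delta / 2 by rewrite divr_gt0.
(* First half: [T <= expR l], while the exponent [p * l ^+ 3 = lam * l ^+ 2] is at least [2 * l]. *)
apply: ltrD.
  apply: le_lt_trans (expRN_lt d2 lB).
  apply: (@le_trans _ _ (expR l * expR (- (p * l ^+ 3)))).
    by rewrite el ler_wpM2r ?expR_ge0.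
  rewrite -expRD ler_expR.
  have -> : p * l ^+ 3 = l * (lam * l) by rewrite /p; field.
  have : 2 * l <= l * (lam * l).
    by rewrite mulrC ler_wpM2l ?(ltW lp) // [lam * l]mulrC -ler_pdivrMr.
  lra.
apply: expRN_lt => //; rewrite -/B.
set M := s / p - ln p.
have cM : M <= (1 + eps / 4) * (s * l / lam).
  have lnp : - ln p <= eps / 4 * s * (l / lam).
    have -> : - ln p = ln (l / lam) by rewrite /p -lnV ?posrE // invf_div.
    apply: hx0; first by rewrite divr_gt0.
    rewrite ler_pdivlMr // mulrC; apply: le_trans lx0.
    by rewrite ler_wpM2l ?ler_norm // ltW.
  have -> : M = s * l / lam - ln p by rewrite /M /p invf_div mulrA.
  have -> : (1 + eps / 4) * (s * l / lam) = s * l / lam + eps / 4 * s * (l / lam).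
    by field.
  by rewrite lerD2l.
have main : eps / 4 * n%:R <= n%:R - T * l ^+ 3 / l ^+ 4 - T - T * M / c.
  have h1 : T * l ^+ 3 / l ^+ 4 <= eps / 4 * n%:R.
    have -> : T * l ^+ 3 / l ^+ 4 = T / l by field.
    rewrite ler_pdivrMr //; apply: le_trans Tn1 _.
    rewrite mulrAC ler_peMl // ?(ltW np) //.
    by move: leps; rewrite ler_pdivrMr // => ?; lra.
  (* Both [T] and [T * s / lam] are inflated by [(1 + eps / 4) / (1 - eps / 4)], which the slack
     [1 - eps] in the bound on [T] absorbs. *)
  have h2 : T + T * M / c <= (1 - eps / 2) * n%:R.
    have e4 : 0 < 1 - eps / 4 by lra.
    have h3 : T * M / c <= (1 + eps / 4) / (1 - eps / 4) * (T * (s / lam)).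
      rewrite ler_pdivrMr // mulrAC.
      have -> : (1 + eps / 4) / (1 - eps / 4) * c * (T * (s / lam))
          = T * ((1 + eps / 4) * (s * l / lam)).
        by rewrite /c; field; apply/andP; split; rewrite // gt_eqF //; lra.
      by rewrite ler_wpM2l.
    have r1 : 1 <= (1 + eps / 4) / (1 - eps / 4) by rewrite ler_pdivlMr //; lra.
    apply: (@le_trans _ _ ((1 + eps / 4) / (1 - eps / 4) * (T * (1 + s / lam)))).
      by rewrite [T * (1 + _)]mulrDr mulr1 mulrDr; apply: lerD => //; rewrite ler_peMl.
    apply: (@le_trans _ _ ((1 + eps / 4) / (1 - eps / 4) * ((1 - eps) * n%:R))).
      by rewrite ler_wpM2l //; lra.
    rewrite mulrA ler_wpM2r // ?(ltW np) // mulrAC ler_pdivrMr //.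
    have : 0 <= eps * eps by rewrite mulr_ge0 // ltW.
    lra.
  lra.
have De : 0 < (1 + l ^+ 4 * l ^+ 3) ^+ 2.
  by rewrite exprn_gt0 // addr_gt0 // mulr_gt0 // exprn_gt0.
apply: (@le_trans _ _
  (p * expR (- c) * ((eps / 4 * n%:R) / (1 + l ^+ 4 * l ^+ 3) ^+ 2))); last first.
  by rewrite ler_wpM2l ?ler_wpM2r ?invr_ge0 ?(ltW De) // mulr_ge0 ?expR_ge0 // ltW.
have De4 : (1 + l ^+ 4 * l ^+ 3) ^+ 2 <= 4 * l ^+ 14.
  have l7 : 1 <= l ^+ 7 by rewrite exprn_ege1.
  rewrite -exprD (_ : l ^+ 14 = l ^+ 7 * l ^+ 7); last by rewrite -exprD.
  (* With [x = l ^+ 7] this product is [4 * x ^+ 2 - (1 + x) ^+ 2]. *)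
  have : 0 <= (l ^+ 7 - 1) * (3 * l ^+ 7 + 1) by rewrite mulr_ge0 //; lra.
  rewrite expr2; lra.
pose y := eps / 4 * l.
have y00 : 0 <= y by rewrite mulr_ge0 ?(ltW lp) // divr_ge0 // ltW.
have yy0 : y0 <= y.
  apply: le_trans (ler_norm _) _; move: ly0.
  by rewrite ler_pdivrMr ?divr_gt0 // mulrC.
have := hy0 y y00 yy0.
rewrite mulrA ler_pdivlMr //.
have -> : p * expR (- c) * (eps / 4 * n%:R) = lam * (eps / 4) / l * expR y.
  have -> : expR y = expR (- c) * n%:R.
    by rewrite -el -expRD; congr expR; rewrite /y /c; lra.
  by rewrite /p; ring.
move=> hA; apply: (@le_trans _ _ (lam * (eps / 4) / l * (A * y ^+ 15))); last first.
  by apply: ler_wpM2l hA; rewrite ltW // divr_gt0 // mulr_gt0 // divr_gt0.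
have -> : lam * (eps / 4) / l * (A * y ^+ 15) = B * (4 * l ^+ 14).
  have -> : y ^+ 15 = (eps / 4) ^+ 15 * (l * l ^+ 14) by rewrite -exprS -exprMn.
  rewrite /A; have e15 : (eps / 4) ^+ 15 != 0 by rewrite gt_eqF // exprn_gt0 // divr_gt0.
  move: ((eps / 4) ^+ 15) e15 => E E0.
  move: (l ^+ 14) => L; field.
  by rewrite E0 ln0 lam0' gt_eqF.
by rewrite ler_wpM2l // ltW.
Qed.
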